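(* Let $d\geq1$ and let $\{a_k\}_{k=0}^\infty$ be a complex sequence which is a solution of the linear recurrence relation $$a_k=\sum_{j=1}^{d}c_j(k)\,a_{k-j},\qquad k=d,d+1,\dots,$$ with uniformly bounded coefficients $c_j(k)\in\mathbb{C}$. Let $(K,\rho)$ be a pair of positive constants satisfying $$|c_j(k)|\leq K\rho^j,\qquad j=1,\dots,d,\quad k=d,d+1,\dots,$$ for which the product $\nu=(2K+2)\rho$ is minimal among all such pairs, and put $R=\nu^{-1}$. Then the series $f(z)=\sum_{k=0}^\infty a_kz^k$ converges in the open disk $D_R$ of radius $R$ centered at $0$ and possesses there $(d-1,R,(2K+2)^{d-1})$-Taylor domination.
   Context: Taylor domination: for a finite $R>0$, an integer $N\geq0$ and a constant $C>0$, the series $f(z)=\sum_{k\geq0}a_kz^k$ possesses $(N,R,C)$-Taylor domination if $|a_k|R^k\leq C\max_{i=0,\dots,N}|a_i|R^i$ for each $k\geq N+1$. *)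

(* Defs.v *)
(* Stdlib reals with Coquelicot's complex numbers and series. *)
From Stdlib Require Export Reals.
From Coquelicot Require Export Coquelicot.
Open Scope R_scope.

(* [Rmax_N u N] is Stdlib's maximum of u 0, ..., u N. *)
Definition taylor_domination (a : nat -> C) (N : nat) (r D : R) : Prop :=
  0 < r /\ 0 < D /\
  forall k : nat, (N + 1 <= k)%nat ->
    Cmod (a k) * r ^ k <= D * Rmax_N (fun i => Cmod (a i) * r ^ i) N.

(* [c j k] stands for c_j(k); since d <= k and j <= d, the natural-number
   subtraction k - j is the usual one. *)
Definition solves_recurrence (d : nat) (c : nat -> nat -> C) (a : nat -> C) : Prop :=
  forall k : nat, (d <= k)%nat ->
    a k = sum_n_m (fun j => Cmult (c j k) (a (k - j)%nat)) 1 d.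

Definition uniformly_bounded (d : nat) (c : nat -> nat -> C) : Prop :=
  exists B : R, forall j k : nat,
    (1 <= j <= d)%nat -> (d <= k)%nat -> Cmod (c j k) <= B.

Definition admissible_pair (d : nat) (c : nat -> nat -> C) (K rho : R) : Prop :=
  0 < K /\ 0 < rho /\
  forall j k : nat,
    (1 <= j <= d)%nat -> (d <= k)%nat -> Cmod (c j k) <= K * rho ^ j.

(* The minimum is not attained when c_j(k) = 0 for all j >= 2 (K can
   then be traded against rho indefinitely); attainment is part of what this
   predicate asserts. *)
Definition minimal_pair (d : nat) (c : nat -> nat -> C) (K rho : R) : Prop :=
  admissible_pair d c K rho /\
  forall K' rho' : R, admissible_pair d c K' rho' ->
    (2 * K + 2) * rho <= (2 * K' + 2) * rho'.

(* [ex_pseries] is instantiated at the complex numbers with the norm [Cmod]. *)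
Definition converges_in_disk (a : nat -> C) (r : R) : Prop :=
  forall z : C, Cmod z < r -> @ex_pseries C_AbsRing C_NormedModule a z.

(* Main.v *)
Require Import Defs.
From Stdlib Require Import Reals Lra Lia Wf_nat.
From Coquelicot Require Import Coquelicot.
Open Scope R_scope.

(** Rescale: put b_k = |a_k| r^k and q = rho r = 1 / (2K + 2).  The recurrence
    and the bounds |c_j(k)| <= K rho^j give
    b_k <= sum_(1 <= j <= d) K q^j b_(k-j), and the choice of q makes
    K q = 1/2 - q <= 1 - q, so that K q^j <= q^(j-1) - q^j.  These weights
    telescope to a total of at most 1 - q^d <= 1: each b_k is at most the
    largest of the d terms before it ([sum_geometric_weights_le]).  By
    induction no b_k exceeds M = max(b_0, ..., b_(d-1))
    ([recurrence_scaled_bound]).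

    Convergence in the open disk of radius r is then Abel's lemma
    ([bounded_converges_in_disk]), and Taylor domination holds with the
    constant 1, hence with (2K + 2)^(d-1), which is at least 1. *)

Lemma le_Rmax_N (u : nat -> R) (N i : nat) : (i <= N)%nat -> u i <= Rmax_N u N.
Proof.
  induction N as [|N IH]; intros Hi; simpl.
  - replace i with 0%nat by lia. lra.
  - destruct (Nat.eq_dec i (S N)) as [->|Hne].
    + apply Rmax_l.
    + apply Rle_trans with (2 := Rmax_r _ _). apply IH. lia.
Qed.

Lemma Cmod_pow_n (z : C) (n : nat) :
  Cmod (@pow_n C_AbsRing z n) = Cmod z ^ n.
Proof.
  induction n as [|n IH]; simpl.
  - exact Cmod_1.
  - rewrite <- IH. exact (Cmod_mult _ _).
Qed.

(** When [K * q <= 1 - q], the weight [K * q ^ j] is at most the telescoping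
    difference [q ^ (j - 1) - q ^ j]. *)
Lemma sum_geometric_weights_le (K q M : R) (x : nat -> R) (n : nat) :
  0 <= q -> K * q <= 1 - q -> 0 <= M ->
  (forall j, (1 <= j <= n)%nat -> x j <= K * q ^ j * M) ->
  sum_n_m x 1 n <= (1 - q ^ n) * M.
Proof.
  intros Hq HKq HM. induction n as [|n IH]; intros Hx.
  - rewrite sum_n_m_zero by lia. unfold zero. simpl. lra.
  - rewrite sum_n_Sm by lia.
    change plus with Rplus.
    assert (Hn : sum_n_m x 1 n <= (1 - q ^ n) * M)
      by (apply IH; intros j Hj; apply Hx; lia).
    assert (HS : x (S n) <= K * q ^ S n * M) by (apply Hx; lia).
    assert (Hw : K * q * (q ^ n * M) <= (1 - q) * (q ^ n * M)).
    { apply Rmult_le_compat_r; [|exact HKq].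
      apply Rmult_le_pos; [apply pow_le|]; assumption. }
    simpl in *. lra.
Qed.

(** Strong induction on the index: the rescaled terms are weighted sums, of
    total weight at most 1, of the [d] preceding ones, so a bound on the first
    [d] of them propagates. *)
Lemma recurrence_scaled_bound (d : nat) (c : nat -> nat -> C) (a : nat -> C)
    (K rho r M : R) :
  solves_recurrence d c a -> admissible_pair d c K rho ->
  0 < r -> K * (rho * r) <= 1 - rho * r -> 0 <= M ->
  (forall i, (i < d)%nat -> Cmod (a i) * r ^ i <= M) ->
  forall k, Cmod (a k) * r ^ k <= M.
Proof.
  intros Hrec [HK [Hrho Hc]] Hr HKq HM Hinit k.
  induction k as [k IH] using lt_wf_ind.
  destruct (Nat.lt_ge_cases k d) as [Hk|Hk]; [now apply Hinit|].
  assert (Hrk : 0 < r ^ k) by now apply pow_lt.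
  rewrite (Hrec k Hk).
  apply Rle_trans with
    (sum_n_m (fun j => r ^ k * Cmod (c j k * a (k - j)%nat)%C) 1 d).
  - rewrite (sum_n_m_mult_l (K := R_Ring)). change mult with Rmult.
    rewrite Rmult_comm. apply Rmult_le_compat_l; [lra|].
    exact (@norm_sum_n_m C_AbsRing C_NormedModule _ 1 d).
  - apply Rle_trans with ((1 - (rho * r) ^ d) * M).
    + apply sum_geometric_weights_le with K; try assumption.
      { apply Rlt_le, Rmult_lt_0_compat; assumption. }
      intros j Hj. rewrite Cmod_mult, Rpow_mult_distr.
      replace (r ^ k) with (r ^ j * r ^ (k - j))
        by (rewrite <- pow_add; f_equal; lia).
      replace (r ^ j * r ^ (k - j) * (Cmod (c j k) * Cmod (a (k - j)%nat)))
        with ((Cmod (c j k) * r ^ j) * (Cmod (a (k - j)%nat) * r ^ (k - j)))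
        by ring.
      replace (K * (rho ^ j * r ^ j) * M) with ((K * rho ^ j * r ^ j) * M)
        by ring.
      assert (Hrj : 0 <= r ^ j) by (apply pow_le; lra).
      assert (Hrkj : 0 <= r ^ (k - j)) by (apply pow_le; lra).
      apply Rmult_le_compat.
      * apply Rmult_le_pos; [apply Cmod_ge_0 | exact Hrj].
      * apply Rmult_le_pos; [apply Cmod_ge_0 | exact Hrkj].
      * apply Rmult_le_compat_r; [exact Hrj | now apply Hc].
      * apply IH. lia.
    + assert (0 <= (rho * r) ^ d * M).
      { apply Rmult_le_pos; [|exact HM].
        apply pow_le, Rlt_le, Rmult_lt_0_compat; assumption. }
      lra.
Qed.

(** Abel's lemma: if [|a_k| r^k <= M], the series at [z] is dominated by the
    geometric series of ratio [|z| / r < 1]. *)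
Lemma bounded_converges_in_disk (a : nat -> C) (r M : R) :
  0 < r -> (forall k, Cmod (a k) * r ^ k <= M) -> converges_in_disk a r.
Proof.
  intros Hr Hb z Hz.
  apply (@ex_series_le C_AbsRing C_CompleteNormedModule _
           (fun k => M * (Cmod z / r) ^ k)).
  - intros k.
    change (Cmod (@pow_n C_AbsRing z k * a k)%C <= M * (Cmod z / r) ^ k).
    rewrite Cmod_mult, Cmod_pow_n.
    replace (Cmod z ^ k * Cmod (a k))
      with (Cmod (a k) * r ^ k * (Cmod z / r) ^ k).
    + apply Rmult_le_compat_r; [|apply Hb].
      apply pow_le, Rdiv_le_0_compat; [apply Cmod_ge_0 | exact Hr].
    + rewrite Rmult_assoc, <- Rpow_mult_distr.
      replace (r * (Cmod z / r)) with (Cmod z) by (field; lra). ring.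
  - apply (ex_series_scal_l (K := R_AbsRing) (V := R_NormedModule) M).
    apply ex_series_geom. rewrite Rabs_pos_eq.
    + apply Rlt_div_l; lra.
    + apply Rdiv_le_0_compat; [apply Cmod_ge_0 | exact Hr].
Qed.

Theorem theorem4p1 (d : nat) (a : nat -> C) (c : nat -> nat -> C) (K rho nu r : R)
  (hd : (1 <= d)%nat)
  (hrec : solves_recurrence d c a)
  (hbdd : uniformly_bounded d c)
  (hmin : minimal_pair d c K rho)
  (hnu : nu = (2 * K + 2) * rho)
  (hr : r = / nu) :
  converges_in_disk a r /\
  taylor_domination a (d - 1) r ((2 * K + 2) ^ (d - 1)).
Proof.
  destruct hmin as [hadm _].
  destruct (hadm) as [HK [Hrho _]].
  assert (Hnu : 0 < nu) by (rewrite hnu; apply Rmult_lt_0_compat; lra).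
  assert (Hr : 0 < r) by (rewrite hr; now apply Rinv_0_lt_compat).
  assert (Hq : (2 * K + 2) * (rho * r) = 1)
    by (rewrite hr, hnu; field; lra).
  assert (Hq0 : 0 < rho * r) by now apply Rmult_lt_0_compat.
  set (M := Rmax_N (fun i => Cmod (a i) * r ^ i) (d - 1)).
  assert (Hinit : forall i, (i < d)%nat -> Cmod (a i) * r ^ i <= M).
  { intros i Hi. apply (le_Rmax_N (fun i => Cmod (a i) * r ^ i)). lia. }
  assert (HM : 0 <= M).
  { apply Rle_trans with (Cmod (a 0%nat) * r ^ 0); [|apply Hinit; lia].
    apply Rmult_le_pos; [apply Cmod_ge_0 | simpl; lra]. }
  assert (Hb : forall k, Cmod (a k) * r ^ k <= M).
  { apply (recurrence_scaled_bound d c a K rho r M); try assumption. lra. }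
  split; [now apply bounded_converges_in_disk with M|].
  assert (HD : 1 <= (2 * K + 2) ^ (d - 1)) by (apply pow_R1_Rle; lra).
  split; [exact Hr|]. split; [lra|].
  intros k _. fold M. apply Rle_trans with (1 * M).
  - rewrite Rmult_1_l. apply Hb.
  - now apply Rmult_le_compat_r.
Qed.
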